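(* Let $n\ge 2$ be an integer. Every matrix $\mathbf{M}\in SU^{[n]}(2)$ can be represented as an expansion in the polyadic full $\Sigma$-matrices by $$\mathbf{M}=\mathbf{X}_0\odot\mathbf{\Sigma}_0+i\,\mathbf{X}_1\odot\mathbf{\Sigma}_1+i\,\mathbf{X}_2\odot\mathbf{\Sigma}_2+i\,\mathbf{X}_3\odot\mathbf{\Sigma}_3,$$ where, for $j=0,1,2,3$, $\mathbf{X}_j$ is the cyclic shift block matrix whose $k$th block is $x_j^{(k)}I_2$ ($k=1,\dots,n-1$), the $x_j^{(k)}$ being real numbers with $(x_0^{(k)})^2+(x_1^{(k)})^2+(x_2^{(k)})^2+(x_3^{(k)})^2=1$ for each $k=1,\dots,n-1$, and $\odot$ is the (block) Hadamard product.
   Context: The $\sigma$-matrices are $\sigma_0=I_2$, $\sigma_1=\begin{pmatrix}0&1\\1&0\end{pmatrix}$, $\sigma_2=\begin{pmatrix}0&-i\\i&0\end{pmatrix}$, $\sigma_3=\begin{pmatrix}1&0\\0&-1\end{pmatrix}$. Matrices of size $2(n-1)\times 2(n-1)$ are viewed as $(n-1)\times(n-1)$ block matrices with $2\times2$ complex blocks. A cyclic shift block matrix with blocks $M^{(1)},\dots,M^{(n-1)}$ is the block matrix having $M^{(k)}$ in block position $(k,k+1)$ for $k=1,\dots,n-2$, $M^{(n-1)}$ in block position $(n-1,1)$, and zero blocks elsewhere (for $n=2$ it is just $M^{(1)}$). The set $SU^{[n]}(2)$ consists of all cyclic shift block matrices whose blocks all lie in $SU(2)$. For $j\in\{0,1,2,3\}$,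 the full $\Sigma$-matrix $\mathbf{\Sigma}_j$ is the cyclic shift block matrix all of whose $n-1$ blocks are equal to $\sigma_j$. The Hadamard product $\odot$ is the element-wise product of $(n-1)\times(n-1)$ matrices whose elements are $2\times 2$ blocks: the block of $\mathbf{A}\odot\mathbf{B}$ in block position $(p,r)$ is the ordinary matrix product $A_{pr}B_{pr}$ of the $2\times2$ blocks of $\mathbf{A}$ and $\mathbf{B}$ in that position. *)

(* Defs.v *)
From HB Require Import structures.
From mathcomp Require Import all_boot all_order all_algebra.
From mathcomp Require Import spectral reals.
From mathcomp Require Import complex.

Set Implicit Arguments.
Unset Strict Implicit.
Unset Printing Implicit Defensive.

Import Order.TTheory GRing.Theory Num.Theory.
Local Open Scope ring_scope.
Local Open Scope complex_scope.

Definition mx2 (T : nzRingType) (a b c d : T) : 'M[T]_2 :=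
  \matrix_(p < 2, r < 2) (nth [::] [:: [:: a; b]; [:: c; d]] p)`_r.

Definition sigma0 (R : realType) : 'M[R[i]]_2 := 1%:M.
Definition sigma1 (R : realType) : 'M[R[i]]_2 := mx2 0 1 1 0.
Definition sigma2 (R : realType) : 'M[R[i]]_2 := mx2 0 (- 'i%C) 'i%C 0.
Definition sigma3 (R : realType) : 'M[R[i]]_2 := mx2 1 0 0 (- 1).

Definition inSU2 (R : realType) (A : 'M[R[i]]_2) : Prop :=
  A \is unitarymx /\ \det A = 1.

(* Complex matrices of size 2(n-1), with the library's block structure of
   (n-1) x (n-1) blocks of size 2 x 2. *)
Notation "''BM[' R ]_ n" := 'M[R[i]]_(\sum_(k < n.-1) 2)
  (at level 8, R at level 200, n at level 2, format "''BM[' R ]_ n").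

(* Block indices are 0-based: [ordS] is the cyclic successor on ['I_n.-1], so
   the last block lands in block position (n-1, 1), and for n = 2 the matrix
   is its only block. *)
Definition cshift (R : realType) (n : nat) (B : 'I_n.-1 -> 'M[R[i]]_2) :
    'BM[R]_n :=
  \mxblock_(p < n.-1, r < n.-1) (if r == ordS p then B p else 0).

Definition inSUn2 (R : realType) (n : nat) (M : 'BM[R]_n) : Prop :=
  exists B : 'I_n.-1 -> 'M[R[i]]_2, (forall k, inSU2 (B k)) /\ M = cshift B.

Definition fullSigma (R : realType) (n : nat) (s : 'M[R[i]]_2) : 'BM[R]_n :=
  cshift (fun _ : 'I_n.-1 => s).

Definition bhadamard (R : realType) (n : nat) (A B : 'BM[R]_n) : 'BM[R]_n :=
  \mxblock_(p < n.-1, r < n.-1) (submxblock A p r *m submxblock B p r).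

Notation "A '(.)' B" := (bhadamard A B) (at level 40, left associativity).

Definition realScalarShift (R : realType) (n : nat) (x : 'I_n.-1 -> R) :
    'BM[R]_n :=
  cshift (fun k => ((x k)%:C)%:M).

(* Main.v *)
Require Import Defs.
From mathcomp Require Import all_boot all_order all_algebra.
From mathcomp Require Import spectral reals.
From mathcomp Require Import complex.
From mathcomp Require Import ring.

Set Implicit Arguments.
Unset Strict Implicit.
Unset Printing Implicit Defensive.

Import Order.TTheory GRing.Theory Num.Theory.
Local Open Scope ring_scope.
Local Open Scope complex_scope.

(* The block Hadamard product of two cyclic shifts is the cyclic shift of the
   blockwise products, so the claim reduces to a single block.  A matrix of
   determinant 1 has its adjugate as inverse, so it is unitary exactly when its
   adjugate is its conjugate transpose; in size 2 this forces the shape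
   [[a, b], [- b^*, a^*]] with |a|^2 + |b|^2 = 1, and the coefficients are read
   off a = x0 + i x3 and b = x2 + i x1. *)

Lemma mxblockZ (S : pzRingType) (p q : nat) (p_ : 'I_p -> nat)
    (q_ : 'I_q -> nat) (a : S) (B : forall i j, 'M[S]_(p_ i, q_ j)) :
  a *: \mxblock_(i, j) B i j = \mxblock_(i, j) (a *: B i j).
Proof. by apply/matrixP=> i j; rewrite !mxE. Qed.

Lemma eq_cshift (R : realType) (n : nat) (B C : 'I_n.-1 -> 'M[R[i]]_2) :
  B =1 C -> cshift B = cshift C.
Proof. by move=> eqBC; apply: eq_mxblock => p r; rewrite eqBC. Qed.

Lemma cshiftD (R : realType) (n : nat) (B C : 'I_n.-1 -> 'M[R[i]]_2) :
  cshift B + cshift C = cshift (fun k => B k + C k).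
Proof.
rewrite -mxblockD; apply: eq_mxblock => p r.
by case: ifP => // _; rewrite addr0.
Qed.

Lemma cshiftZ (R : realType) (n : nat) (a : R[i]) (B : 'I_n.-1 -> 'M[R[i]]_2) :
  a *: cshift B = cshift (fun k => a *: B k).
Proof.
rewrite mxblockZ; apply: eq_mxblock => p r.
by case: ifP => // _; rewrite scaler0.
Qed.

(** Both factors vanish off the same cyclic block positions, and there the product is 0 times 0. *)
Lemma bhadamard_cshift (R : realType) (n : nat) (B C : 'I_n.-1 -> 'M[R[i]]_2) :
  cshift B (.) cshift C = cshift (fun k => B k *m C k).
Proof.
apply: eq_mxblock => p r; rewrite !mxblockK.
by case: ifP => // _; rewrite mul0mx.
Qed.

Lemma adj_unitarymx (C : numClosedFieldType) (n : nat) (A : 'M[C]_n) :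
  A \is unitarymx -> \det A = 1 -> \adj A = (A ^t*)%sesqui.
Proof.
move=> /unitarymxP AA' detA.
by rewrite -[LHS]mulmx1 -AA' mulmxA mul_adj_mx detA mul1mx.
Qed.

Lemma adj_mx2 (S : comNzRingType) (A : 'M[S]_2) :
  \adj A = mx2 (A 1 1) (- A 0 1) (- A 1 0) (A 0 0).
Proof.
have lift0 : lift 0 0 = 1 :> 'I_2 by apply/val_inj.
have lift1 : lift 1 0 = 0 :> 'I_2 by apply/val_inj.
(* [unliftP 0] splits an index of ['I_2] into 0 and the lift of the only element of ['I_1], which is
   1. *)
apply/matrixP=> p r; case: (unliftP 0 p) => [?|] ->;
  case: (unliftP 0 r) => [?|] ->; rewrite ?ord1 ?lift0;
  by rewrite !mxE /cofactor det_mx11 !mxE ?lift0 ?lift1 ?mul1r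
    ?mulN1r ?expr2 ?mulN1r ?opprK ?mul1r.
Qed.

Lemma eq_mx2 (S : nzRingType) (A : 'M[S]_2) :
  A = mx2 (A 0 0) (A 0 1) (A 1 0) (A 1 1).
Proof.
have lift0 : lift 0 0 = 1 :> 'I_2 by apply/val_inj.
by apply/matrixP=> p r; case: (unliftP 0 p) => [?|] ->;
  case: (unliftP 0 r) => [?|] ->; rewrite ?ord1 ?lift0 mxE.
Qed.

(** Since [i sigma1 = [[0, i], [i, 0]]], [i sigma2 = [[0, 1], [-1, 0]]] and
    [i sigma3 = diag(i, -i)], the imaginary part of [b] goes with [sigma1] and its real part with
    [sigma2]. *)
Lemma SU2_sigmaE (R : realType) (A : 'M[R[i]]_2) (a := A 0 0) (b := A 0 1) :
  inSU2 A ->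
  complex.Re a ^+ 2 + complex.Im b ^+ 2 + complex.Re b ^+ 2
    + complex.Im a ^+ 2 = 1 /\
  A = (complex.Re a)%:C%:M *m sigma0 R
      + 'i%C *: ((complex.Im b)%:C%:M *m sigma1 R)
      + 'i%C *: ((complex.Re b)%:C%:M *m sigma2 R)
      + 'i%C *: ((complex.Im a)%:C%:M *m sigma3 R).
Proof.
case=> unitA detA; have /matrixP adjA := adj_unitarymx unitA detA.
rewrite adj_mx2 in adjA.
(* Comparing entries of the adjugate and the conjugate transpose gives [A 1 1 = a^*] and
   [A 1 0 = - b^*]. *)
have := adjA 0 0; rewrite !mxE /= -/a => A11.
have := adjA 1 0; rewrite !mxE /= -/b => /(canRL opprK) A10.
(* The first row has norm 1: [a a^* + b b^* = 1], whose real part is the sum of four squares. *)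
have /matrixP/(_ 0 0) := unitarymxP unitA.
rewrite !mxE !big_ord_recl big_ord0 !mxE addr0 -/a.
have -> : lift 0 0 = 1 :> 'I_2 by apply/val_inj.
rewrite -/b [A]eq_mx2 -/a -/b A11 A10.
clearbody a b; case: a b {A11 A10} => [a1 a2] [b1 b2] /= => ab1; split.
  move/(congr1 (@complex.Re R)): ab1 => /= <-; ring.
apply/matrixP=> p r; case: (unliftP 0 p) => [?|] ->;
  case: (unliftP 0 r) => [?|] ->; rewrite ?ord1 !mul_scalar_mx !mxE;
  (* The real and imaginary parts of each entry are polynomial identities in [a1], [a2], [b1],
     [b2]. *)
  by apply/eqP; rewrite eq_complex /=; apply/andP; split; apply/eqP; ring.
Qed.

Theorem theorem4p10 (R : realType) (n : nat) (hn : (2 <= n)%N)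
    (M : 'BM[R]_n) (hM : inSUn2 M) :
  exists x0 x1 x2 x3 : 'I_n.-1 -> R,
    (forall k : 'I_n.-1,
      x0 k ^+ 2 + x1 k ^+ 2 + x2 k ^+ 2 + x3 k ^+ 2 = 1) /\
    M = realScalarShift x0 (.) fullSigma n (sigma0 R)
        + 'i%C *: (realScalarShift x1 (.) fullSigma n (sigma1 R))
        + 'i%C *: (realScalarShift x2 (.) fullSigma n (sigma2 R))
        + 'i%C *: (realScalarShift x3 (.) fullSigma n (sigma3 R)).
Proof.
case: hM => B [SU2B ->].
exists (fun k => complex.Re (B k 0 0)), (fun k => complex.Im (B k 0 1)).
exists (fun k => complex.Re (B k 0 1)), (fun k => complex.Im (B k 0 0)).
split=> [k|]; first by have [] := SU2_sigmaE (SU2B k).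
rewrite !bhadamard_cshift !cshiftZ !cshiftD; apply: eq_cshift => k.
by have [] := SU2_sigmaE (SU2B k).
Qed.
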